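(* Let $\varphi:\mathbb R_+^2\to\mathbb R_+$ satisfy properties (I)–(III) listed in the context, and fix an interior initial market state $\mathbf R^{\mathsf{in}}\in(\mathbb R_{++}^2)^3$. If $\mathbf R\in\mathcal F(\mathbf R^{\mathsf{in}})$ is an interior feasible state, then $\mathbf R$ is reachable from $\mathbf R^{\mathsf{in}}$ by a finite valid trading sequence. Moreover, the trading sequence can be chosen so that all intermediate market states are interior.
   Context: Notation: $\mathbb R_+=[0,\infty)$, $\mathbb R_{++}=(0,\infty)$. Properties of a function $u:\mathbb R_+^2\to\mathbb R_+$: (I) $u$ is continuous, $u(x,0)=u(0,y)=0$ for all $x,y\in\mathbb R_+$, and $u$ is strictly increasing (in each coordinate) on $\mathbb R_{++}^2$. (II) $\lim_{x'\to\infty}u(x',y)=\infty$ and $\lim_{y'\to\infty}u(x,y')=\infty$ for every $x,y>0$. (III) $u$ is continuously differentiable and strictly concave on $\mathbb R_{++}^2$. Market: there is one constant-function market maker (CFMM) with trading function $\varphi$ and two agents. A market state is $\mathbf R=(\mathbf r_0,\mathbf r_1,\mathbf r_2)\in(\mathbb R_+^2)^3$ ($\mathbf r_0$ = CFMM inventory, $\mathbf r_i$ = holding of agent $i$); it is interior if it lies in $(\mathbb R_{++}^2)^3$. The feasible set $\mathcal F(\mathbf R^{\mathsf{in}})$ is the set of market states $\mathbf R$ with $\mathbf r_0+\mathbf r_1+\mathbf r_2=\mathbf r_0^{\mathsf{in}}+\mathbf r_1^{\mathsf{in}}+\mathbf r_2^{\mathsf{in}}$ and $\varphi(\mathbf r_0)=\varphi(\mathbf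 r_0^{\mathsf{in}})$. A trade $\mathbf h\in\mathbb R^2$ is valid for $\mathbf R$ and agent $i\in\{1,2\}$ if $\mathbf r_0+\mathbf h\in\mathbb R_+^2$, $\varphi(\mathbf r_0+\mathbf h)=\varphi(\mathbf r_0)$ and $\mathbf r_i-\mathbf h\in\mathbb R_+^2$; executing it replaces $\mathbf r_0$ by $\mathbf r_0+\mathbf h$ and $\mathbf r_i$ by $\mathbf r_i-\mathbf h$ and leaves the other agent's holding unchanged. A finite valid trading sequence from $\mathbf R^{\mathsf{in}}$ to $\mathbf R$ is a finite sequence of market states $\mathbf R^0=\mathbf R^{\mathsf{in}},\mathbf R^1,\dots,\mathbf R^T=\mathbf R$, $T\in\mathbb N$, in which each $\mathbf R^{t+1}$ is obtained from $\mathbf R^t$ by executing a valid trade by one of the two agents. *)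

(* Defs.v *)
From HB Require Import structures.
From mathcomp Require Import all_boot all_order all_algebra.
From mathcomp Require Import all_classical all_reals all_analysis.

Set Implicit Arguments.
Unset Strict Implicit.
Unset Printing Implicit Defensive.

Import Order.TTheory GRing.Theory Num.Theory.
Import numFieldNormedType.Exports.

Local Open Scope classical_set_scope.
Local Open Scope ring_scope.

Section TradingFunctions.
Context {R : realType}.

Definition quadrant : set (R * R) := [set p | 0 <= p.1 /\ 0 <= p.2].

Definition open_quadrant : set (R * R) := [set p | 0 < p.1 /\ 0 < p.2].

(* A function u : R_+^2 -> R_+ is represented by a total u : R * R -> R that
   is nonnegative on the quadrant. The predicates below, and all later uses of
   u, do not depend on its values outside the quadrant. *)
Definition nonneg_on_quadrant (u : R * R -> R) : Prop :=
  forall p, quadrant p -> 0 <= u p.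

Definition strictly_increasing (u : R * R -> R) : Prop :=
  (forall x x' y, 0 < x -> 0 < y -> x < x' -> u (x, y) < u (x', y)) /\
  (forall x y y', 0 < x -> 0 < y -> y < y' -> u (x, y) < u (x, y')).

Definition property_I (u : R * R -> R) : Prop :=
  [/\ {within quadrant, continuous u},
      (forall x, 0 <= x -> u (x, 0) = 0),
      (forall y, 0 <= y -> u (0, y) = 0)
    & strictly_increasing u].

Definition property_II (u : R * R -> R) : Prop :=
  (forall y, 0 < y -> u (x, y) @[x --> +oo] --> +oo) /\
  (forall x, 0 < x -> u (x, y) @[y --> +oo] --> +oo).

(* In finite dimension, continuity of p |-> 'D_v u p for every fixed v is
   continuity of the differential p |-> 'd u p. *)
Definition continuously_differentiable (u : R * R -> R) : Prop :=
  forall p, open_quadrant p ->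
    differentiable u p /\
    forall v : R * R, {for p, continuous (fun q => 'D_v u q)}.

Definition strictly_concave (u : R * R -> R) : Prop :=
  forall p q (t : R), open_quadrant p -> open_quadrant q -> p <> q ->
    0 < t -> t < 1 ->
    t * u p + (1 - t) * u q < u (t *: p + (1 - t) *: q).

Definition property_III (u : R * R -> R) : Prop :=
  continuously_differentiable u /\ strictly_concave u.

End TradingFunctions.

Inductive agent : Set := Agent1 | Agent2.

(* The coordinates range over all of R^2; nonnegativity is [market_state]. *)
Record state (R : realType) : Type := State {
  pool : R * R;
  holding1 : R * R;
  holding2 : R * R
}.

Section Market.
Context {R : realType}.

Definition holding (S : state R) (i : agent) : R * R :=
  match i with Agent1 => holding1 S | Agent2 => holding2 S end.

Definition market_state (S : state R) : Prop :=
  quadrant (pool S) /\ forall i, quadrant (holding S i).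

Definition interior_state (S : state R) : Prop :=
  open_quadrant (pool S) /\ forall i, open_quadrant (holding S i).

Definition feasible_set (phi : R * R -> R) (Rin : state R) : set (state R) :=
  [set S | [/\ market_state S,
      pool S + holding1 S + holding2 S =
        pool Rin + holding1 Rin + holding2 Rin
    & phi (pool S) = phi (pool Rin)]].

Definition valid_trade (phi : R * R -> R) (S : state R) (i : agent)
    (h : R * R) : Prop :=
  [/\ quadrant (pool S + h),
      phi (pool S + h) = phi (pool S)
    & quadrant (holding S i - h)].

Definition execute (S : state R) (i : agent) (h : R * R) : state R :=
  match i with
  | Agent1 => State (pool S + h) (holding1 S - h) (holding2 S)
  | Agent2 => State (pool S + h) (holding1 S) (holding2 S - h)
  end.

(* Only the values s 0, ..., s T of s are relevant. *)
Definition valid_trading_sequence (phi : R * R -> R) (Rin Rout : state R)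
    (T : nat) (s : nat -> state R) : Prop :=
  [/\ s 0%N = Rin, s T = Rout,
      (forall t, (t <= T)%N -> market_state (s t))
    & forall t, (t < T)%N ->
        exists i h, valid_trade phi (s t) i h /\ s t.+1 = execute (s t) i h].

Definition reachable (phi : R * R -> R) (Rin Rout : state R) : Prop :=
  exists T s, valid_trading_sequence phi Rin Rout T s.

End Market.

(* Main.v *)
Require Import Defs.
From HB Require Import structures.
From mathcomp Require Import all_boot all_order all_algebra.
From mathcomp Require Import all_classical all_reals all_analysis.
From mathcomp Require Import ring lra.
Import Order.TTheory GRing.Theory Num.Theory.
Import numFieldNormedType.Exports.
Local Open Scope classical_set_scope.
Local Open Scope ring_scope.

(* If one agent trades the pool from p to q along the level curve of phi and the
   other agent trades it back, the pool is unchanged and q - p, or p - q in the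
   other order, has moved between the agents; the intermediate state is interior
   as soon as both ends are. Near p the level curve is the graph of a continuous
   function g, strictly convex since phi is strictly concave. The second
   differences (0, g(x+2h) - 2g(x+h) + g(x)) are then sums of three such
   transfers and range over all small vertical vectors, so at a fixed pool every
   small transfer, and by subdividing segments every transfer, can be realized.
   It remains to change the pool, in one trade of agent 2, after agent 1's holding
   has been made small enough for agent 2 to afford it. *)

(** * Level curves as graphs of continuous functions *)

Lemma continuous_slice1 (R : realType) (phi : R * R -> R) (x y : R) :
  {for (x, y), continuous phi} -> {for x, continuous (fun x => phi (x, y))}.
Proof.
move=> phi_cont; apply: (@cvg_comp _ _ _ (fun x => (x, y)) phi _ (nbhs (x, y))).
  by apply: (@cvg_pair _ _ _ (nbhs x) (nbhs x) (nbhs y));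
    [exact: cvg_id|exact: cvg_cst].
exact: phi_cont.
Qed.

Lemma continuous_slice2 (R : realType) (phi : R * R -> R) (x y : R) :
  {for (x, y), continuous phi} -> {for y, continuous (fun y => phi (x, y))}.
Proof.
move=> phi_cont; apply: (@cvg_comp _ _ _ (fun y => (x, y)) phi _ (nbhs (x, y))).
  by apply: (@cvg_pair _ _ _ (nbhs y) (nbhs x) (nbhs y));
    [exact: cvg_cst|exact: cvg_id].
exact: phi_cont.
Qed.

(** The strict inequalities [phi (x0, y0 - e) < phi (x0, y0) < phi (x0, y0 + e)] persist for [x]
    near [x0]; the intermediate value theorem on the vertical segment then gives [y]. *)
Lemma level_curve_near (R : realType) (phi : R * R -> R) (x0 y0 eta : R) :
  (forall p, open_quadrant p -> {for p, continuous phi}) ->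
  strictly_increasing phi -> 0 < x0 -> 0 < y0 -> 0 < eta ->
  \forall x \near x0,
    exists y, [/\ 0 < y, `|y - y0| < eta & phi (x, y) = phi (x0, y0)].
Proof.
move=> phi_cont [_ phi_incr] x0_gt0 y0_gt0 eta_gt0.
have [e [e_gt0 e_eta e_y0]] : exists e, [/\ 0 < e, e < eta & e < y0].
  exists (Num.min eta y0 / 2).
  by rewrite /Num.min; case: ifP => ?; split; lra.
have cont_x y : 0 < y -> phi (x, y) @[x --> x0] --> phi (x0, y).
  by move=> y_gt0; apply: continuous_slice1; exact: phi_cont.
have lo : phi (x0, y0 - e) < phi (x0, y0) by apply: phi_incr => //; lra.
have hi : phi (x0, y0) < phi (x0, y0 + e) by apply: phi_incr => //; lra.
have ylo_gt0 : 0 < y0 - e by lra.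
have yhi_gt0 : 0 < y0 + e by lra.
have nlo := cvgr_lt _ (cont_x _ ylo_gt0) _ lo.
have nhi := cvgr_gt _ (cont_x _ yhi_gt0) _ hi.
near=> x.
have x_gt0 : 0 < x by near: x; exact: lt_nbhsr.
have xlo : phi (x, y0 - e) < phi (x0, y0) by near: x; exact: nlo.
have xhi : phi (x0, y0) < phi (x, y0 + e) by near: x; exact: nhi.
have [||| y + phixy] := @IVT R (fun y => phi (x, y)) (y0 - e) (y0 + e) (phi (x0, y0)).
- lra.
- apply: continuous_in_subspaceT => y; rewrite inE /= in_itv /= => /andP[y1 y2].
  by apply: continuous_slice2; apply: phi_cont; split => /=; lra.
- by rewrite ge_min le_max (ltW xlo) (ltW xhi) orbT.
rewrite in_itv /= => /andP[y1 y2]; exists y; split => //; first lra.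
by rewrite ltr_norml; lra.
Unshelve. all: by end_near. Qed.

(** Strict monotonicity in [y] makes the level point over each [x] unique, so [level_curve_near] at
    [(x, g x)], with arbitrary tolerance, is continuity of [g] at [x]. *)
Lemma level_curve_graph (R : realType) (phi : R * R -> R) (x0 y0 : R) :
  (forall p, open_quadrant p -> {for p, continuous phi}) ->
  strictly_increasing phi -> 0 < x0 -> 0 < y0 ->
  exists (rho : R) (g : R -> R), 0 < rho /\ forall x, `|x - x0| < rho ->
    [/\ 0 < x, 0 < g x, phi (x, g x) = phi (x0, y0) & {for x, continuous g}].
Proof.
move=> phi_cont phi_mono x0_gt0 y0_gt0.
(* The default [0] is taken only where the vertical line misses the level. *)
pose g x := xget 0 [set y | 0 < y /\ phi (x, y) = phi (x0, y0)].
have g_uniq x y : 0 < x -> 0 < y -> phi (x, y) = phi (x0, y0) -> g x = y.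
  move=> x_gt0 y_gt0 phixy; rewrite /g; case: xgetP => [z _ [z_gt0 phixz]|].
    have [zy|yz|//] := ltgtP z y.
      by have := phi_mono.2 _ _ _ x_gt0 z_gt0 zy; rewrite phixz phixy ltxx.
    by have := phi_mono.2 _ _ _ x_gt0 y_gt0 yz; rewrite phixz phixy ltxx.
  by move=> /(_ y) /= [].
have : \forall x \near x0,
    0 < x /\ exists y, [/\ 0 < y, `|y - y0| < 1 & phi (x, y) = phi (x0, y0)].
  near=> x; split; first by near: x; exact: lt_nbhsr.
  by near: x; apply: level_curve_near.
move=> /nbhs_ballP[rho /= rho_gt0 near_x0].
exists rho, g; split=> // x x_near.
have gP z : `|z - x0| < rho -> [/\ 0 < z, 0 < g z & phi (z, g z) = phi (x0, y0)].
  rewrite distrC => /near_x0[z_gt0 [y [y_gt0 _ phizy]]].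
  by rewrite (g_uniq _ _ z_gt0 y_gt0 phizy).
have [x_gt0 gx_gt0 phix] := gP _ x_near; split=> //.
apply/cvgrPdist_lt => eta eta_gt0.
have := @level_curve_near R phi x (g x) eta phi_cont phi_mono x_gt0 gx_gt0 eta_gt0.
apply: filterS2 (lt_nbhsr x_gt0) => z z_gt0 [y [y_gt0 y_eta phizy]].
by rewrite (g_uniq z y) ?phizy // distrC.
Unshelve. all: by end_near. Qed.

(** * Moving inside a box by steps along a curve *)

Definition open_box {R : realType} (M : R * R) : set (R * R) :=
  [set r | 0 < r.1 < M.1 /\ 0 < r.2 < M.2].

Section BoxTransitivity.
(** [P r r'] will say that, at a fixed pool and total holdings [M], agent 1 can go from [r] to [r'];
    in [open_box M] both agents hold positive amounts. [f] will be the level curve translated to the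
    origin, and [f_convex] is strict midpoint convexity between [0] and [2 * h], as [f 0 = 0]. *)
Context {R : realType} (M : R * R) (P : R * R -> R * R -> Prop).
Context (f : R -> R) (rho : R).
Hypotheses (rho_gt0 : 0 < rho) (f0 : f 0 = 0).
Hypothesis f_cont : forall t : R, `|t| < rho -> {for t, continuous f}.
Hypothesis f_convex : forall h : R, 0 < h -> 2 * h < rho -> 2 * f h < f (2 * h).
Hypothesis P_trans : forall a b c, P a b -> P b c -> P a c.
Hypothesis P_add : forall (r : R * R) (t : R), `|t| < rho -> open_box M r ->
  open_box M (r + (t, f t)) -> P r (r + (t, f t)).
Hypothesis P_sub : forall (r : R * R) (t : R), `|t| < rho -> open_box M r ->
  open_box M (r - (t, f t)) -> P r (r - (t, f t)).

Let box_margin (e : R) (r : R * R) :=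
  e <= r.1 <= M.1 - e /\ e <= r.2 <= M.2 - e.

Let f_small (e : R) : 0 < e ->
  exists d, [/\ 0 < d, d <= rho, d <= e & forall t, `|t| < d -> `|f t| < e].
Proof.
move=> e_gt0.
have f_cont0 : {for 0, continuous f} by apply: f_cont; rewrite normr0.
have /cvgrPdist_lt/(_ _ e_gt0)/nbhs_ballP[d /= d_gt0 fd] := f_cont0.
exists (Num.min d (Num.min rho e)); split.
- by rewrite !lt_min d_gt0 rho_gt0.
- by rewrite !ge_min lexx orbT.
- by rewrite !ge_min lexx !orbT.
move=> t; rewrite lt_min => /andP[td _].
by have := fd t; rewrite /ball /= sub0r normrN => /(_ td); rewrite f0 sub0r normrN.
Qed.

(* The second difference f(2h) - 2 f(h) vanishes at h = 0 and is positive for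
   small h, so it takes every small positive value. *)
Let vertical_move (e : R) : 0 < e -> exists2 w0, 0 < w0 &
  forall r w, `|w| <= w0 -> box_margin e r -> P r (r + (0, w)).
Proof.
move=> e_gt0.
(* Three values of [f], each below [e / 4], displace a point by less than [e], so all intermediate
   points stay in the box. *)
have e4_gt0 : 0 < e / 4 by lra.
have [d [d_gt0 d_rho d_e fd]] := f_small _ e4_gt0.
pose W h := f (2 * h) - 2 * f h.
have W0 : W 0 = 0 by rewrite /W mulr0 f0 mulr0 subr0.
have Wpos : 0 < W (d / 4).
  by rewrite subr_gt0; apply: f_convex; lra.
exists (W (d / 4)) => // r w ww0 [r1 r2].
have [h [h1 h2 Wh]] : exists h, [/\ 0 <= h, h <= d / 4 & W h = `|w|].
  have [||| h + Wh] := @IVT R W 0 (d / 4) `|w|.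
  - lra.
  - apply: continuous_in_subspaceT => h; rewrite inE /= in_itv /= => /andP[h1 h2].
    apply: cvgB.
      apply: (@cvg_comp _ _ _ (fun h => 2 * h) f _ (nbhs (2 * h))).
        by apply: cvgMl_tmp; exact: cvg_id.
      by apply: f_cont; rewrite ger0_norm; lra.
    by apply: cvgMl_tmp; apply: f_cont; rewrite ger0_norm; lra.
  - by rewrite W0 ge_min normr_ge0 /= le_max ww0 orbT.
  by rewrite in_itv /= => /andP[h1 h2]; exists h.
have hd : `|h| < d by rewrite ger0_norm; lra.
have h2d : `|2 * h| < d by rewrite ger0_norm; lra.
have /ltr_normlP[fh1 fh2] := fd _ hd.
have /ltr_normlP[fh3 fh4] := fd _ h2d.
have hrho : `|h| < rho by exact: lt_le_trans d_rho.
have h2rho : `|2 * h| < rho by exact: lt_le_trans d_rho.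
have [w_ge0|w_lt0] := leP 0 w.
- rewrite ger0_norm // in Wh.
  have -> : r + (0, w) = r + (2 * h, f (2 * h)) - (h, f h) - (h, f h).
    by apply: injective_projections => /=; rewrite -?Wh /W; ring.
  apply: P_trans; last apply: P_trans.
  + by apply: (@P_add r (2 * h)) => //; split => /=; lra.
  + by apply: (@P_sub _ h) => //; split => /=; lra.
  + by apply: (@P_sub _ h) => //; split => /=; lra.
- rewrite ltr0_norm // in Wh.
  have -> : r + (0, w) = r - (2 * h, f (2 * h)) + (h, f h) + (h, f h).
    by rewrite -[w]opprK -Wh; apply: injective_projections => /=; rewrite /W; ring.
  apply: P_trans; last apply: P_trans.
  + by apply: (@P_sub r (2 * h)) => //; split => /=; lra.
  + by apply: (@P_add _ h) => //; split => /=; lra.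
  + by apply: (@P_add _ h) => //; split => /=; lra.
Qed.

(** A curve step [(v.1, f v.1)] produces the horizontal part of [v]; a vertical move corrects the
    rest, [v.2 - f v.1]. *)
Let small_move (e : R) : 0 < e -> exists2 d, 0 < d &
  forall r v, `|v.1| < d -> `|v.2| < d -> box_margin e r -> P r (r + v).
Proof.
move=> e_gt0.
have e2_gt0 : 0 < e / 2 by lra.
have [w0 w0_gt0 vert] := vertical_move _ e2_gt0.
(* [m <= e / 2] leaves margin [e / 2] after the curve step; [m <= w0 / 2] bounds the correction by
   [w0]. *)
have [m [m_gt0 m_e m_w0]] : exists m, [/\ 0 < m, m <= e / 2 & m <= w0 / 2].
  exists (Num.min (e / 2) (w0 / 2)).
  by rewrite lt_min !ge_min !lexx orbT; split => //; apply/andP; split; lra.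
have [d [d_gt0 d_rho d_m fd]] := f_small _ m_gt0.
exists d => // r v v1d v2d [r1 r2].
have /ltr_normlP[fv1 fv2] := fd _ v1d.
have /ltr_normlP[v1 v2] := v1d.
have /ltr_normlP[v3 v4] := v2d.
have -> : r + v = r + (v.1, f v.1) + (0, v.2 - f v.1).
  by apply: injective_projections => /=; ring.
apply: P_trans.
  apply: (@P_add r v.1); [lra| |]; split => /=; lra.
apply: vert; last by split => /=; lra.
by rewrite ler_norml; lra.
Qed.

(** The segment from [r] to [r'] keeps, by convexity, a margin common to its ends, so one step size
    serves along all of it and finitely many small moves suffice. *)
Lemma open_box_transitive (r r' : R * R) :
  open_box M r -> open_box M r' -> P r r'.
Proof.
case: r r' => [a b] [a' b'] [/= ha hb] [/= ha' hb'].
have [e [e_gt0 m1 m2]] :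
    exists e, [/\ 0 < e, box_margin e (a, b) & box_margin e (a', b')].
  pose e := \big[Num.min/1]_(x <- [:: a; b; a'; b'; M.1 - a; M.1 - a'; M.2 - b; M.2 - b']) x.
  exists e; rewrite /box_margin /=.
  have : 0 < e by rewrite /e !big_cons big_nil !lt_min; lra.
  (* Unfolding only the right-hand [e] yields its eight upper bounds. *)
  have : e <= e by [].
  by rewrite {2}/e !big_cons big_nil !le_min; split => //; lra.
have [d d_gt0 move_small] := small_move e e_gt0.
have [N [N_gt0 Na Nb]] : exists N : nat,
    [/\ (0 < N)%N, `|a' - a| < d * N%:R & `|b' - b| < d * N%:R].
  have := archi_boundP (divr_ge0 (addr_ge0 (normr_ge0 (a' - a)) (normr_ge0 (b' - b))) (ltW d_gt0)).
  set N := Num.bound _; rewrite ltr_pdivrMr // mulrC => HN.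
  have ? := normr_ge0 (a' - a); have ? := normr_ge0 (b' - b).
  exists N; split; [|lra|lra].
  by rewrite lt0n; apply/eqP => N0; move: HN; rewrite N0 mulr0; lra.
have N_gt0' : 0 < N%:R :> R by rewrite ltr0n.
pose v : R * R := ((a' - a) / N%:R, (b' - b) / N%:R).
have v1 : `|v.1| < d by rewrite /= normrM normfV (gtr0_norm N_gt0') ltr_pdivrMr.
have v2 : `|v.2| < d by rewrite /= normrM normfV (gtr0_norm N_gt0') ltr_pdivrMr.
pose r n : R * R := (a + n%:R * v.1, b + n%:R * v.2).
have r0 : r 0 = (a, b) by rewrite /r !mul0r !addr0.
have rN : r N = (a', b').
  by rewrite /r /v /=; congr pair; field; rewrite gt_eqF.
have r_margin n : (n <= N)%N -> box_margin e (r n).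
  move=> nN; pose s : R := n%:R / N%:R.
  have s_ge0 : 0 <= s by rewrite divr_ge0.
  have s_le1 : s <= 1 by rewrite ler_pdivrMr // mul1r ler_nat.
  have -> : r n = (a + s * (a' - a), b + s * (b' - b)).
    by rewrite /r /v /s /=; congr pair; field; rewrite gt_eqF.
  move: m1 m2; rewrite /box_margin /= => -[??] [??].
  by split; apply/andP; split; nra.
have P_r n : (n <= N)%N -> P (a, b) (r n).
  elim: n => [_|n IH nN].
    (* Reflexivity of [P] at [(a, b)] comes from the zero move. *)
    have := move_small (a, b) 0; rewrite addr0 r0 => H.
    by apply: H => //=; rewrite normr0.
  apply: P_trans (IH (ltnW nN)) _.
  have -> : r n.+1 = r n + v.
    by rewrite /r; apply: injective_projections => /=; rewrite -natr1; ring.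
  by apply: move_small => //; apply: r_margin; exact: ltnW.
by rewrite -rN; apply: P_r.
Qed.

End BoxTransitivity.

(** * Chains of trades through interior states *)

Inductive interior_trades (R : realType) (phi : R * R -> R) (S : state R) :
    state R -> Prop :=
| interior_trades_refl : interior_state S -> interior_trades R phi S S
| interior_trades_step S' i h : interior_trades R phi S S' ->
    valid_trade phi S' i h -> interior_state (execute S' i h) ->
    interior_trades R phi S (execute S' i h).

Arguments interior_trades {R}.

Section InteriorTrades.
Context {R : realType} (phi : R * R -> R).

Lemma open_quadrantW (p : R * R) : open_quadrant p -> quadrant p.
Proof. by move=> [p1 p2]; split; exact: ltW. Qed.

Lemma interior_stateW (S : state R) : interior_state S -> market_state S.
Proof.
by move=> [S0 S12]; split=> [|i]; apply: open_quadrantW; [exact: S0|exact: S12].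
Qed.

(** With chains given inductively, concatenation is an induction on the second chain, without gluing
    indexed sequences. *)
Lemma interior_trades_trans (S1 S2 S3 : state R) :
  interior_trades phi S1 S2 -> interior_trades phi S2 S3 ->
  interior_trades phi S1 S3.
Proof.
move=> S12; elim=> [//|S i h _ S1S valid int].
exact: interior_trades_step.
Qed.

Lemma interior_trades_sequence (S S' : state R) : interior_trades phi S S' ->
  exists (T : nat) (s : nat -> state R),
    valid_trading_sequence phi S S' T s /\
    forall t : nat, (t <= T)%N -> interior_state (s t).
Proof.
elim=> [S_int|{}S' i h _ [T [s [[s0 sT s_mkt s_step] s_int]]] valid int].
  exists 0%N, (fun=> S); split=> //; split=> // t _.
  exact: interior_stateW.
exists T.+1, (fun t => if (t <= T)%N then s t else execute S' i h).
have s'_int t : (t <= T.+1)%N ->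
    interior_state (if (t <= T)%N then s t else execute S' i h).
  by move=> _; case: ifP => // tT; exact: s_int.
split=> //; split; rewrite ?ltnn //.
  by move=> t tT; apply: interior_stateW; exact: s'_int.
move=> t; rewrite ltnS => tT; rewrite tT.
move: tT; rewrite leq_eqVlt => /orP[/eqP->|tT].
  by rewrite ltnn sT; exists i, h.
by rewrite tT; exact: s_step.
Qed.

Lemma interior_trade1 (p q r1 r2 : R * R) : open_quadrant p -> open_quadrant q ->
  phi q = phi p -> open_quadrant r1 -> open_quadrant r2 ->
  open_quadrant (r1 + p - q) ->
  interior_trades phi (State p r1 r2) (State q (r1 + p - q) r2).
Proof.
move=> p_gt0 q_gt0 phiqp r1_gt0 r2_gt0 r1'_gt0.
have E : State q (r1 + p - q) r2 = execute (State p r1 r2) Agent1 (q - p).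
  by rewrite /= subrKC opprB addrA.
have int : interior_state (State q (r1 + p - q) r2) by split=> // -[].
rewrite E; apply: interior_trades_step; last by rewrite -E.
  by apply: interior_trades_refl; split=> // -[].
split=> /=; rewrite ?subrKC ?opprB ?addrA //; exact: open_quadrantW.
Qed.

Lemma interior_trade2 (p q r1 r2 : R * R) : open_quadrant p -> open_quadrant q ->
  phi q = phi p -> open_quadrant r1 -> open_quadrant r2 ->
  open_quadrant (r2 + p - q) ->
  interior_trades phi (State p r1 r2) (State q r1 (r2 + p - q)).
Proof.
move=> p_gt0 q_gt0 phiqp r1_gt0 r2_gt0 r2'_gt0.
have E : State q r1 (r2 + p - q) = execute (State p r1 r2) Agent2 (q - p).
  by rewrite /= subrKC opprB addrA.
have int : interior_state (State q r1 (r2 + p - q)) by split=> // -[].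
rewrite E; apply: interior_trades_step; last by rewrite -E.
  by apply: interior_trades_refl; split=> // -[].
split=> /=; rewrite ?subrKC ?opprB ?addrA //; exact: open_quadrantW.
Qed.

End InteriorTrades.

(** * Transfers between the agents at a fixed pool *)

Section FixedPool.
Context {R : realType} (phi : R * R -> R).
Hypothesis phi_cont : forall p, open_quadrant p -> {for p, continuous phi}.
Hypothesis phi_mono : strictly_increasing phi.
Hypothesis phi_concave : strictly_concave phi.

(* The trades p -> q by one agent and q -> p by the other one return the pool
   to p and transfer q - p between the two agents. *)
Lemma fixed_pool_connected (p r r' M : R * R) : open_quadrant p ->
  open_box M r -> open_box M r' ->
  interior_trades phi (State p r (M - r)) (State p r' (M - r')).
Proof.
case: p => x0 y0 [/= x0_gt0 y0_gt0].
have [rho [g [rho_gt0 gP]]] :=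
  level_curve_graph R phi x0 y0 phi_cont phi_mono x0_gt0 y0_gt0.
have g_x0 : g x0 = y0.
  have [|_ gx0 phix0 _] := gP x0; first by rewrite subrr normr0.
  have [lt|lt|//] := ltgtP (g x0) y0.
    by have := phi_mono.2 _ _ _ x0_gt0 gx0 lt; rewrite phix0 ltxx.
  by have := phi_mono.2 _ _ _ x0_gt0 y0_gt0 lt; rewrite phix0 ltxx.
(* The level curve with the pool [(x0, y0)] moved to the origin. *)
pose f t := g (x0 + t) - y0.
pose q t : R * R := (x0 + t, g (x0 + t)).
have qP t : `|t| < rho -> open_quadrant (q t) /\ phi (q t) = phi (x0, y0).
  move=> trho; have [|x_gt0 g_gt0 phix _] := gP (x0 + t); first by rewrite addrAC subrr add0r.
  by split.
have f_def t : (t, f t) = q t - (x0, y0).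
  by apply: injective_projections => //=; rewrite /f; ring.
apply: (@open_box_transitive R M
  (fun r r' => interior_trades phi (State (x0, y0) r (M - r))
                               (State (x0, y0) r' (M - r'))) f rho).
- by [].
- by rewrite /f addr0 g_x0 subrr.
- move=> t trho; have [|_ _ _ gc] := gP (x0 + t); first by rewrite addrAC subrr add0r.
  apply: cvgB; last exact: cvg_cst.
  apply: (@cvg_comp _ _ _ (fun t => x0 + t) g _ (nbhs (x0 + t))); last exact: gc.
  by apply: cvgD; [exact: cvg_cst|exact: cvg_id].
- move=> h h_gt0 h_rho; rewrite /f.
  have [|[_ gh_gt0] phih] := qP h; first by rewrite gtr0_norm; lra.
  have [|q2_gt0 phi2h] := qP (2 * h); first by rewrite gtr0_norm; lra.
  have g2_gt0 := q2_gt0.2; rewrite /= in gh_gt0 g2_gt0.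
  (* By strict concavity the midpoint of a chord of the level curve has a larger value of [phi], so
     by monotonicity the curve passes strictly below it. *)
  have mid : phi (x0, y0) < phi (x0 + h, (y0 + g (x0 + 2 * h)) / 2).
    have := phi_concave (x0, y0) (q (2 * h)) (1 / 2) (conj x0_gt0 y0_gt0) q2_gt0.
    rewrite phi2h => H.
    have -> : (x0 + h, (y0 + g (x0 + 2 * h)) / 2) =
        (1 / 2) *: (x0, y0) + (1 - 1 / 2) *: q (2 * h).
      by apply: injective_projections => /=; rewrite /GRing.scale /=; field.
    by apply: le_lt_trans (H _ _ _); [lra| |lra|lra] => -[]; lra.
  rewrite ltNge; apply/negP => mid_le.
  have : (y0 + g (x0 + 2 * h)) / 2 <= g (x0 + h) by lra.
  rewrite le_eqVlt => /orP[/eqP E|lt].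
    by move: mid; rewrite E -phih ltxx.
  have : phi (x0 + h, (y0 + g (x0 + 2 * h)) / 2) < phi (x0 + h, g (x0 + h)).
    by apply: phi_mono.2 => //; lra.
  by rewrite [X in _ < X]phih => /(lt_trans mid); rewrite ltxx.
- by move=> a b c; exact: interior_trades_trans.
(* Agent 2 moves the pool to [q t] and agent 1 moves it back, so each holding takes only its initial
   and final values, both positive. For the opposite transfer agent 1 goes first. *)
- move=> s t trho [s1 s2] [s1' s2']; rewrite f_def in s1' s2' *.
  have [q_gt0 phiq] := qP t trho; rewrite /= in s1' s2'.
  have -> : M - (s + (q t - (x0, y0))) = M - s + (x0, y0) - q t.
    by rewrite opprD opprB !addrA.
  apply: interior_trades_trans.
    apply: (@interior_trade2 R phi (x0, y0) (q t)) => //; split => /=; lra.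
  have -> : s + (q t - (x0, y0)) = s + q t - (x0, y0) by rewrite addrA.
  by apply: interior_trade1 => //; split => /=; lra.
- move=> s t trho [s1 s2] [s1' s2']; rewrite f_def in s1' s2' *.
  have [q_gt0 phiq] := qP t trho; rewrite /= in s1' s2'.
  have -> : s - (q t - (x0, y0)) = s + (x0, y0) - q t by rewrite opprB addrA.
  apply: interior_trades_trans.
    apply: (@interior_trade1 R phi (x0, y0) (q t)) => //; split => /=; lra.
  have -> : M - (s + (x0, y0) - q t) = M - s + q t - (x0, y0).
    by apply: injective_projections => /=; ring.
  by apply: interior_trade2 => //; split => /=; lra.
Qed.

End FixedPool.

(** * Changing the pool between two fixed-pool transfers *)

Theorem theorem4 (R : realType) (phi : R * R -> R)
    (phi_ge0 : nonneg_on_quadrant phi)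
    (phi_I : property_I phi) (phi_II : property_II phi)
    (phi_III : property_III phi)
    (Rin : state R) (Rin_interior : interior_state Rin)
    (Rout : state R) (Rout_feasible : feasible_set phi Rin Rout)
    (Rout_interior : interior_state Rout) :
  reachable phi Rin Rout /\
  exists (T : nat) (s : nat -> state R),
    valid_trading_sequence phi Rin Rout T s /\
    forall t : nat, (t <= T)%N -> interior_state (s t).
Proof.
have phi_cont p : open_quadrant p -> {for p, continuous phi}.
  by move=> /phi_III.1[phi_diff _]; exact: differentiable_continuous.
have phi_mono : strictly_increasing phi by case: phi_I.
suff trades : interior_trades phi Rin Rout.
  have [T [s [s_valid s_int]]] := interior_trades_sequence _ _ _ trades.
  by split; exists T, s.
case: Rin Rin_interior Rout_feasible => p r1 r2 [p_gt0 r_gt0].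
case: Rout Rout_interior => p' r1' r2' [p'_gt0 r'_gt0] [_ /= total phip].
have /= [r1_gt0 r2_gt0] := (r_gt0 Agent1, r_gt0 Agent2).
have /= [r1'_gt0 r2'_gt0] := (r'_gt0 Agent1, r'_gt0 Agent2).
have box (r s : R * R) : open_quadrant r -> open_quadrant s -> open_box (r + s) r.
  by move=> [??] [??]; split => /=; lra.
have connected M q s s' : open_quadrant q -> open_box M s -> open_box M s' ->
    interior_trades phi (State q s (M - s)) (State q s' (M - s')).
  exact: fixed_pool_connected phi_cont phi_mono phi_III.2 q s s' M.
(* While agent 1 holds d, agent 2 holds enough for the pool to be moved from p
   to p' in one trade. *)
have [d [d_gt0 d_box d_box']] : exists d : R * R,
    [/\ open_quadrant d, open_box (r1 + r2) d & open_box (r1' + r2') d].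
  (* [d] is the coordinatewise minimum of [r1] and [r1'], hence below both totals. *)
  have common (a a' m m' : R) : 0 < a < m -> 0 < a' < m' ->
      exists d, [/\ 0 < d, 0 < d < m & 0 < d < m'].
    by move=> ? ?; exists (Num.min a a'); have [] := leP a a'; split; lra.
  have [r_box1 r_box2] := box _ _ r1_gt0 r2_gt0.
  have [r'_box1 r'_box2] := box _ _ r1'_gt0 r2'_gt0.
  have [d1 [? ? ?]] := common _ _ _ _ r_box1 r'_box1.
  have [d2 [? ? ?]] := common _ _ _ _ r_box2 r'_box2.
  by exists (d1, d2).
have to_d := connected _ _ _ _ p_gt0 (box _ _ r1_gt0 r2_gt0) d_box.
have from_d := connected _ _ _ _ p'_gt0 d_box' (box _ _ r1'_gt0 r2'_gt0).
have addKl (a b : R * R) : a + b - a = b by rewrite addrC addKr.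
rewrite addKl in to_d; rewrite addKl in from_d.
(* By conservation of the total, the trade from [p] to [p'] leaves agent 2 with exactly the holding
   from which the transfer at [p'] starts. *)
have holding2_d : r1 + r2 - d + p - p' = r1' + r2' - d.
  have -> : r1' + r2' = p + r1 + r2 - p' by rewrite -total -(addrA p') addKl.
  by apply: injective_projections => /=; ring.
apply: interior_trades_trans to_d _; apply: interior_trades_trans from_d.
rewrite -holding2_d.
have diff_gt0 M : open_box M d -> open_quadrant (M - d).
  by move=> [/andP[_ ?] /andP[_ ?]]; split => /=; rewrite subr_gt0.
by apply: interior_trade2 => //; rewrite ?holding2_d; apply: diff_gt0.
Qed.
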